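(* Any DC map $F \colon \mathbb{R}^d \to \mathbb{S}^{\ell}$ is componentwise DC.
   Context: $\mathbb{S}^{\ell}$ is the space of real symmetric matrices of order $\ell$, with the Löwner partial order: $A \preceq B$ iff $B - A$ is positive semidefinite. A map $F \colon \mathbb{R}^d \to \mathbb{S}^{\ell}$ is convex if $F(\alpha x_1 + (1-\alpha) x_2) \preceq \alpha F(x_1) + (1 - \alpha) F(x_2)$ for all $x_1, x_2 \in \mathbb{R}^d$, $\alpha \in [0,1]$; it is DC if $F = G - H$ for some convex maps $G, H \colon \mathbb{R}^d \to \mathbb{S}^{\ell}$. A map $F \colon \mathbb{R}^d \to \mathbb{S}^{\ell}$ is componentwise convex if each component $F_{ij}(\cdot)$ is a convex real-valued function; it is componentwise DC if $F = G - H$ for some componentwise convex maps $G, H \colon \mathbb{R}^d \to \mathbb{S}^{\ell}$. *)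

(* Defs.v *)
From HB Require Import structures.
From mathcomp Require Import all_boot all_order all_algebra.
From mathcomp Require Import classical_sets reals convex.

Set Implicit Arguments.
Unset Strict Implicit.
Unset Printing Implicit Defensive.

Import Order.TTheory GRing.Theory Num.Theory.
Local Open Scope classical_set_scope.
Local Open Scope ring_scope.

Section SymmetricMatrices.
Variables (R : realType) (l : nat).

(* Membership-predicate form of the library qualifier, on which the submodule
   closure, hence the R-vector space structure of symmx, can be declared. *)
Definition symmetric_pred : {pred 'M[R]_l} := fun A => A \is symmetricmx.

Lemma symmetric_predE (A : 'M[R]_l) : (A \in symmetric_pred) = (A == A^T).
Proof.
rewrite -topredE /= /symmetric_pred qualifE /= expr0 scale1r.
by congr (_ == _); apply/matrixP=> i j; rewrite !mxE.
Qed.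

Fact symmetric_pred_submod_closed : submod_closed symmetric_pred.
Proof.
split; first by rewrite symmetric_predE trmx0.
move=> a A B; rewrite !symmetric_predE => /eqP sA /eqP sB.
by rewrite linearD linearZ /= -sA -sB.
Qed.

HB.instance Definition _ :=
  GRing.isSubmodClosed.Build R 'M[R]_l symmetric_pred
    symmetric_pred_submod_closed.

Record symmx := Symmx {
  mx_of_symmx :> 'M[R]_l;
  symmxP : mx_of_symmx \in symmetric_pred }.

HB.instance Definition _ := [isSub for mx_of_symmx].
HB.instance Definition _ := [Choice of symmx by <:].
HB.instance Definition _ := [SubChoice_isSubLmodule of symmx by <:].

End SymmetricMatrices.

Notation "''S[' R ]_ l" := (symmx R l)
  (at level 8, l at level 2, format "''S[' R ]_ l") : type_scope.

Section Loewner.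
Variables (R : realType) (l : nat).

(* Symmetry of A is carried by its type. *)
Definition psd (A : 'S[R]_l) : Prop :=
  forall v : 'cV[R]_l, 0 <= (v^T *m A *m v) ord0 ord0.

Definition loewner_le (A B : 'S[R]_l) : Prop := psd (B - A).

End Loewner.

Section DC.
Variables (R : realType) (d l : nat).
Implicit Types F : 'rV[R]_d -> 'S[R]_l.

Definition convex_map F : Prop :=
  forall (x1 x2 : 'rV[R]_d) (a : R), 0 <= a <= 1 ->
    loewner_le (F (a *: x1 + (1 - a) *: x2)) (a *: F x1 + (1 - a) *: F x2).

Definition DC_map F : Prop :=
  exists G H : 'rV[R]_d -> 'S[R]_l,
    [/\ convex_map G, convex_map H & forall x, F x = G x - H x].

Definition componentwise_convex F : Prop :=
  forall i j : 'I_l,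
    convex_function (setT : set (convex_lmodType 'rV[R]_d))
      (fun x => F x i j : R^o).

Definition componentwise_DC F : Prop :=
  exists G H : 'rV[R]_d -> 'S[R]_l,
    [/\ componentwise_convex G, componentwise_convex H
      & forall x, F x = G x - H x].

End DC.

(* Main.v *)
Require Import Defs.
From mathcomp Require Import all_boot all_order all_algebra reals.
From mathcomp Require Import classical_sets interval_inference convex ring lra.

(** If [G] is convex then so is [(e_i + e_j)^T G (e_i + e_j) = G_ii + 2 G_ij + G_jj]
    for all [i, j] (including [i = j], which covers the diagonal entries).
    So when [F = G - H] with [G], [H] convex, adding to both [G] and [H] the
    symmetric map with entries [((G + H)_ii + (G + H)_jj) / 2] makes every
    component of either one convex and leaves the difference unchanged. *)

Set Implicit Arguments.
Unset Strict Implicit.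
Unset Printing Implicit Defensive.

Import Order.TTheory GRing.Theory Num.Theory.
Local Open Scope ring_scope.

Section SymmxEntries.
Variables (R : realType) (l : nat).
Implicit Types A B : 'S[R]_l.

Lemma symmx_sym A i j : A i j = A j i.
Proof.
by have:= symmxP A; rewrite symmetric_predE => /eqP {1}->; rewrite mxE.
Qed.

Lemma symmxDE A B i j : (A + B) i j = A i j + B i j.
Proof.
have -> : (A + B : 'M_l) = (A : 'M_l) + B := raddfD val A B.
by rewrite mxE.
Qed.

Lemma symmxBE A B i j : (A - B) i j = A i j - B i j.
Proof.
have -> : (A - B : 'M_l) = (A : 'M_l) - B := raddfB val A B.
by rewrite !mxE.
Qed.

Lemma symmxZE (a : R) A i j : (a *: A) i j = a * A i j.
Proof.
have -> : (a *: A : 'M_l) = a *: (A : 'M_l) := GRing.valZ a A.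
by rewrite mxE.
Qed.

(** Test the quadratic form at [e_i + e_j]; symmetry merges the two cross terms. *)
Lemma psd_entries A i j : psd A -> 0 <= A i i + A i j *+ 2 + A j j.
Proof.
move=> /(_ (delta_mx i ord0 + delta_mx j ord0)).
rewrite [(_ + _)^T]linearD /= !trmx_delta mulmxDl -!rowE mulmxDr -!colE !mxE.
by rewrite (symmx_sym A j i) mulr2n !addrA.
Qed.

Fact diag_half_sum_sym A :
  \matrix_(i, j) ((A i i + A j j) / 2) \in symmetric_pred (R := R) (l := l).
Proof.
by rewrite symmetric_predE; apply/eqP/matrixP => i j; rewrite !mxE addrC.
Qed.

Definition diag_half_sum A : 'S[R]_l := Symmx (diag_half_sum_sym A).

Lemma diag_half_sumE A i j : diag_half_sum A i j = (A i i + A j j) / 2.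
Proof. by rewrite mxE. Qed.

End SymmxEntries.

Section ConvexMaps.
Variables (R : realType) (d l : nat).
Implicit Types G H : 'rV[R]_d -> 'S[R]_l.

(** [q] is linear in the matrix, so [psd_entries] applies to the Loewner gap. *)
Lemma convex_map_entries G i j (x y : 'rV[R]_d) (a : R) :
  convex_map G -> 0 <= a <= 1 ->
  let q z := G z i i + G z i j *+ 2 + G z j j in
  q (a *: x + (1 - a) *: y) <= a * q x + (1 - a) * q y.
Proof.
move=> cG a01 /=; have /(psd_entries i j) := cG x y a a01.
rewrite !(symmxBE, symmxDE, symmxZE); lra.
Qed.

(** The shifted entry is [(G_ii + 2 G_ij + G_jj) / 2 + H_ii / 2 + H_jj / 2], a sum of convex
    functions. *)
Lemma componentwise_convex_shift G H : convex_map G -> convex_map H ->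
  componentwise_convex (fun x => G x + diag_half_sum (G x + H x)).
Proof.
move=> cG cH i j t x y _ _.
have t01 : 0 <= t%:num <= 1 by rewrite ge0 le1.
pose E z := (G z + diag_half_sum (G z + H z)) i j.
(* The abstract convex combinations unfold to explicit ones, with [t] weighing the first point. *)
change (E (t%:num *: x + (1 - t%:num) *: y)
        <= t%:num * E x + (1 - t%:num) * E y).
rewrite /E !(symmxDE, diag_half_sumE).
have /= qG := convex_map_entries i j x y cG t01.
(* With equal indices the expression is four times the diagonal entry. *)
have /= qHi := convex_map_entries i i x y cH t01.
have /= qHj := convex_map_entries j j x y cH t01.
lra.
Qed.

End ConvexMaps.

Theorem corollary3 (R : realType) (d l : nat) (F : 'rV[R]_d -> 'S[R]_l) :
  DC_map F -> componentwise_DC F.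
Proof.
move=> [G [H [cG cH FGH]]].
exists (fun x => G x + diag_half_sum (G x + H x)),
       (fun x => H x + diag_half_sum (H x + G x)).
split; [exact: componentwise_convex_shift..|] => x.
(* Both shifts depend only on [G x + H x], so they cancel. *)
by rewrite FGH (addrC (H x) (G x)) opprD addrACA subrr addr0.
Qed.
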